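(* Let $x$ be a semi-discrete BrLW surface in $\mathbb{H}^3$ and $n$ the semi-discrete BiLW surface in $\mathbb{S}^{2,1}$ described by a semi-discrete holomorphic function $g$ (with the same constants $s$ and $\lambda$) via the Weierstrass-type representation. Then their mean and Gaussian curvatures $H^x,K^x$ (of $x$) and $H^n,K^n$ (of $n$) satisfy $$2s(H^{x}-1)+(1-s)(K^{x}-1)=0,\qquad 2s(H^{n}-1)-(1+s)(K^{n}-1)=0.$$
   Context: Semi-discrete maps are maps $y(k,t)$ on a subdomain of $\mathbb{Z}\times\mathbb{R}$, smooth in $t$; write $y=y(k,t)$, $y_1=y(k+1,t)$, $\partial y=\frac{d}{dt}y$, $\Delta y=y_1-y$. $\mathbb{R}^{3,1}=\{(z_1,z_2,z_3,z_0)\}$ has metric $z\circ w=z_1w_1+z_2w_2+z_3w_3-z_0w_0$ and is identified with Hermitian $2\times2$ matrices by $(z_1,z_2,z_3,z_0)\mapsto\begin{pmatrix} z_0+z_3 & z_1-iz_2 \\ z_1+iz_2 & z_0-z_3 \end{pmatrix}$, so that $z\circ z=-\det$. $\mathbb{H}^3$ is the set of vectors with $z\circ z=-1$ (both sheets) and $\mathbb{S}^{2,1}$ the set of vectors with $z\circ z=1$. A semi-discrete holomorphic function is a map $g(k,t)\in\mathbb{C}$ with $\partial g$ and $\Delta g$ never zero and $\dfrac{\partial g\,\partial g_1}{(\Delta g)^2}=\dfrac{\tau(t)}{\sigma(k)}<0$ for real-valued functions $\tau$ of $t$ and $\sigma$ of $k$. Weierstrass-type representation: let $g$ be semi-discrete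 holomorphic, $s\in\mathbb{R}$ with $\mathcal{T}:=1+s|g|^2\neq0$ everywhere, $\lambda\in\mathbb{R}\setminus\{0\}$ with $1-\lambda\sigma\neq0$. Let $E$ be a $\mathrm{GL}_2\mathbb{C}$-valued solution, with $\det E$ real, of $$E^{-1}\Delta E=\begin{pmatrix}0&\Delta g\\ \frac{\lambda\sigma}{\Delta g}&0\end{pmatrix},\qquad E^{-1}\partial E=\begin{pmatrix}0&\partial g\\ \frac{\lambda\tau}{\partial g}&0\end{pmatrix},$$ let $L=\begin{pmatrix}0&\sqrt{\mathcal{T}}\\ \frac{-1}{\sqrt{\mathcal{T}}}&\frac{-s\overline g}{\sqrt{\mathcal{T}}}\end{pmatrix}$, and set $$x=\frac{\mathrm{sgn}(\mathcal{T})}{\det E}EL(\overline{EL})^t\in\mathbb{H}^3,\qquad n=\frac{\mathrm{sgn}(\mathcal{T})}{\det E}EL\begin{pmatrix}1&0\\0&-1\end{pmatrix}(\overline{EL})^t\in\mathbb{S}^{2,1}.$$ Then $x$ is called a semi-discrete BrLW surface and $n$ a semi-discrete BiLW surface. One has $\partial x\parallel\partial n$ and $\Delta x\parallel\Delta n$. Mixed area: for semi-discrete maps $x,y$ into $\mathbb{R}^{3,1}$ with $\partial x\parallel\partial y$, $\Delta x\parallel\Delta y$, $$A(x,y)=\tfrac14\big((\partial x+\partial x_1)\wedge\Delta y+(\partial y+\partial y_1)\wedge\Delta x\big),\qquad (a\wedge b)c:=(a\circ c)b-(b\circ c)a .$$ The Gaussian and mean curvatures are functions on edges $[x,x_1]$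 defined (where the mixed area dividing is nonzero) by $A(n,n)=K^xA(x,x)$, $A(x,n)=-H^xA(x,x)$ for $x$, and, regarding $x$ as the normal of $n$, by $A(x,x)=K^nA(n,n)$, $A(x,n)=-H^nA(n,n)$ for $n$. *)

(* Defs.v *)
From HB Require Import structures.
From mathcomp Require Import all_boot all_order all_algebra spectral.
From mathcomp Require Import complex.
From mathcomp Require Import all_classical all_reals all_analysis.

Set Implicit Arguments.
Unset Strict Implicit.
Unset Printing Implicit Defensive.

Import Order.TTheory GRing.Theory Num.Theory.
Import numFieldNormedType.Exports.

Local Open Scope classical_set_scope.
Local Open Scope sesquilinear_scope.
Local Open Scope complex_scope.
Local Open Scope ring_scope.

Section Defs.
Variable R : realType.

(* A semi-discrete map is a total function [int -> R -> V], of which only the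
   values on a domain D are meaningful.  The domain is given by its slices:
   (k, t) belongs to it when [D k t]. *)

Definition sd_domain (D : int -> set R) : Prop := forall k, open (D k).

(* Both endpoints of the edge [y(k,t), y(k+1,t)] lie over the domain. *)
Definition edge (D : int -> set R) (k : int) (t : R) : Prop :=
  D k t /\ D (k + 1) t.

Definition sdiff (V : zmodType) (y : int -> R -> V) (k : int) (t : R) : V :=
  y (k + 1) t - y k t.

(* Infinite differentiability on an open set. *)
Definition smooth_on (U : set R) (f : R -> R) : Prop :=
  forall (m : nat) t, U t -> derivable (derive1n m f) t 1.

(* R[i] has no normed module structure over R in the library, so smoothness
   and the derivative of complex functions of a real variable are taken on
   real and imaginary parts. *)
Definition csmooth_on (U : set R) (f : R -> R[i]) : Prop :=
  smooth_on U (fun u => complex.Re (f u)) /\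
  smooth_on U (fun u => complex.Im (f u)).

Definition cderive (f : R -> R[i]) (t : R) : R[i] :=
  derive1 (fun u => complex.Re (f u)) t +i* derive1 (fun u => complex.Im (f u)) t.

Definition cmx_derive (p q : nat) (F : R -> 'M[R[i]]_(p, q)) (t : R) :
  'M[R[i]]_(p, q) := \matrix_(i, j) cderive (fun u => F u i j) t.

Definition mx2 (T : Type) (a b c d : T) : 'M[T]_2 :=
  \matrix_(i < 2, j < 2)
    if i == 0 then (if j == 0 then a else b) else (if j == 0 then c else d).

(* A vector (z_1, z_2, z_3, z_0) of R^{3,1} is a row of length 4, with the
   timelike coordinate z_0 last. *)
Definition z1 (z : 'rV[R]_4) : R := z 0 (inord 0).
Definition z2 (z : 'rV[R]_4) : R := z 0 (inord 1).
Definition z3 (z : 'rV[R]_4) : R := z 0 (inord 2).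
Definition z0 (z : 'rV[R]_4) : R := z 0 (inord 3).

Definition lorentz (z w : 'rV[R]_4) : R :=
  z1 z * z1 w + z2 z * z2 w + z3 z * z3 w - z0 z * z0 w.

Definition herm_mx (z : 'rV[R]_4) : 'M[R[i]]_2 :=
  mx2 (z0 z + z3 z)%:C            (z1 z -i* z2 z)
      (z1 z +i* z2 z)             (z0 z - z3 z)%:C.

Definition sd_holomorphic (D : int -> set R) (g : int -> R -> R[i])
    (tau : R -> R) (sigma : int -> R) : Prop :=
  [/\ forall k, csmooth_on (D k) (g k),
      forall k t, D k t -> cderive (g k) t != 0,
      forall k t, edge D k t -> sdiff g k t != 0
    & forall k t, edge D k t ->
        cderive (g k) t * cderive (g (k + 1)) t / sdiff g k t ^+ 2
          = (tau t / sigma k)%:C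
        /\ tau t / sigma k < 0].

Definition calT (s : R) (z : R[i]) : R[i] := 1 + s%:C * `|z| ^+ 2.

Definition weierstrass_frame (D : int -> set R) (g : int -> R -> R[i])
    (tau : R -> R) (sigma : int -> R) (lambda : R)
    (E : int -> R -> 'M[R[i]]_2) : Prop :=
  [/\ forall k i j, csmooth_on (D k) (fun t => E k t i j),
      forall k t, D k t -> E k t \in unitmx,
      forall k t, D k t -> \det (E k t) \is Num.real,
      forall k t, edge D k t ->
        invmx (E k t) *m sdiff E k t =
          mx2 0                                    (sdiff g k t)
              ((lambda * sigma k)%:C / sdiff g k t) 0
    & forall k t, D k t ->
        invmx (E k t) *m cmx_derive (E k) t =
          mx2 0                                     (cderive (g k) t)
              ((lambda * tau t)%:C / cderive (g k) t) 0].

(* [sqrtC] is the complex square root: [calT s z] may be negative. *)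
Definition weierstrass_L (s : R) (z : R[i]) : 'M[R[i]]_2 :=
  let r := sqrtC (calT s z) in
  mx2 0         r
      (-1 / r)  (- s%:C * z^* / r).

Definition weierstrass_mx (s : R) (z : R[i]) (E M : 'M[R[i]]_2) :
    'M[R[i]]_2 :=
  let EL := E *m weierstrass_L s z in
  (Num.sg (calT s z) / \det E) *: (EL *m M *m EL ^t*).

(* x is the BrLW surface and n the BiLW surface given by g and the frame E. *)
Definition BrLW_BiLW (D : int -> set R) (g : int -> R -> R[i]) (s : R)
    (E : int -> R -> 'M[R[i]]_2) (x n : int -> R -> 'rV[R]_4) : Prop :=
  forall k t, D k t ->
    herm_mx (x k t) = weierstrass_mx s (g k t) (E k t) 1%:M /\
    herm_mx (n k t) = weierstrass_mx s (g k t) (E k t) (mx2 1 0 0 (-1)).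

Definition wedge (a b : 'rV[R]_4) : 'rV[R]_4 -> 'rV[R]_4 :=
  fun c => lorentz a c *: b - lorentz b c *: a.

Definition mixed_area (x y : int -> R -> 'rV[R]_4) (k : int) (t : R) :
    'rV[R]_4 -> 'rV[R]_4 :=
  4^-1 *: (wedge (derive1 (x k) t + derive1 (x (k + 1)) t) (sdiff y k t)
         + wedge (derive1 (y k) t + derive1 (y (k + 1)) t) (sdiff x k t)).

(* Curvatures of x with respect to its normal n on the edge at (k, t).  They
   are meaningful when [mixed_area x x k t != 0], in which case at most one
   number satisfies the defining equation. *)
Definition gauss_curvature (x n : int -> R -> 'rV[R]_4) (k : int) (t : R) : R :=
  get [set K : R | mixed_area n n k t = K *: mixed_area x x k t].

Definition mean_curvature (x n : int -> R -> 'rV[R]_4) (k : int) (t : R) : R :=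
  get [set H : R | mixed_area x n k t = - H *: mixed_area x x k t].

End Defs.

(* Main.v *)
(* In the frame E, x and n are the members (a, b) = (1, 1 - s) and (-1, 1 + s)
   of one pencil a P + b M of Hermitian matrices.  Its t-derivative and its
   difference have directions Y and W independent of (a, b); the t-derivatives
   at the two ends of an edge and the difference are coplanar (this uses the
   cross-ratio condition on g).  Hence all the mixed areas on an edge are
   multiples of one bivector Y /\ W, and with
     e = lambda sigma / |Delta g|^2,  th = 1 / (T T_1),
   up to a common factor,
     A(x,x) = (1-s)^2 th^2 - e^2,  A(n,n) = (1+s)^2 th^2 - e^2,
     A(x,n) = (1-s^2) th^2 + e^2,
   so that (1-s) A(n,n) - 2s A(x,n) - (1+s) A(x,x) = 0, from which both
   relations follow. *)
Require Import Defs.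
From mathcomp Require Import all_boot all_order all_algebra.
From mathcomp Require Import spectral ring.
From mathcomp Require Import complex.
From mathcomp Require Import all_classical all_reals all_analysis.

Import Order.TTheory GRing.Theory Num.Theory.
Import numFieldNormedType.Exports.

Set Implicit Arguments.
Unset Strict Implicit.
Unset Printing Implicit Defensive.

Local Open Scope classical_set_scope.
Local Open Scope sesquilinear_scope.
Local Open Scope complex_scope.
Local Open Scope ring_scope.

(** * Scalar multiples of vectors and self-conjugate complex numbers *)

Lemma solve_scaled (F : fieldType) (W : lmodType F) (a b c : F) (u v z : W) :
  b != 0 -> a *: u - b *: z = c *: v -> z = (a / b) *: u - (c / b) *: v.
Proof.
move=> b0 H; apply: (scalerI b0); rewrite scalerBr !scalerA.
rewrite ![b * _]mulrC !divfK //.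
by rewrite -H opprB addrCA subrr addr0.
Qed.

Lemma conj_real_complex (R : rcfType) (x : R) :
  Num.conj (x%:C) = x%:C :> R[i].
Proof. exact: conjc_real. Qed.

Lemma complex_conj_fixed (R : rcfType) (z : R[i]) :
  Num.conj z = z -> z = (complex.Re z)%:C.
Proof.
by move=> zz; apply/esym/RRe_real/CrealP; exact: zz.
Qed.

(** * Differentiation rules for complex functions of a real variable *)

Section ComplexDerivative.
Variable R : realType.
Implicit Types (f g : R -> R[i]) (t : R).

(** A relational form of [cderive]: differentiability travels with the value, so the rules below
    compose without side conditions. *)
Definition is_cderive f t (df : R[i]) : Prop :=
  is_derive t 1 (fun u => complex.Re (f u)) (complex.Re df) /\
  is_derive t 1 (fun u => complex.Im (f u)) (complex.Im df).

Lemma is_cderive_eq f t df df' :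
  is_cderive f t df -> df = df' -> is_cderive f t df'.
Proof. by move=> ? <-. Qed.

Lemma is_cderive_smooth (U : set R) f t :
  csmooth_on U f -> U t -> is_cderive f t (cderive f t).
Proof.
move=> [reU imU] Ut; split; rewrite /= derive1E; apply: derivableP.
- exact: (reU 0%N).
- exact: (imU 0%N).
Qed.

Lemma is_cderive_cst (c : R[i]) t : is_cderive (fun=> c) t 0.
Proof. by split; exact: is_derive_cst. Qed.

Lemma is_cderiveD f g t df dg : is_cderive f t df -> is_cderive g t dg ->
  is_cderive (fun u => f u + g u) t (df + dg).
Proof.
move=> [rf mf] [rg mg]; split.
- rewrite [X in is_derive _ _ X _](_ : _ =
    (fun u => complex.Re (f u)) + (fun u => complex.Re (g u))); last first.
    by apply/funext => u /=; rewrite fctE; case: (f u) (g u) => ? ? [].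
  by rewrite raddfD; exact: is_deriveD.
- rewrite [X in is_derive _ _ X _](_ : _ =
    (fun u => complex.Im (f u)) + (fun u => complex.Im (g u))); last first.
    by apply/funext => u /=; rewrite fctE; case: (f u) (g u) => ? ? [].
  by rewrite raddfD; exact: is_deriveD.
Qed.

Lemma is_cderiveM f g t df dg : is_cderive f t df -> is_cderive g t dg ->
  is_cderive (fun u => f u * g u) t (f t * dg + df * g t).
Proof.
move=> [rf mf] [rg mg]; split.
- rewrite [X in is_derive _ _ X _](_ : _ =
    (fun u => complex.Re (f u)) * (fun u => complex.Re (g u))
    - (fun u => complex.Im (f u)) * (fun u => complex.Im (g u))); last first.
    by apply/funext => u /=; rewrite !fctE; case: (f u) (g u) => ? ? [].
  apply: is_derive_eq.
  case: (f t) (g t) df dg {rf mf rg mg} => ? ? [? ?] [? ?] [? ?] /=.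
  by rewrite /GRing.scale /=; ring.
- rewrite [X in is_derive _ _ X _](_ : _ =
    (fun u => complex.Re (f u)) * (fun u => complex.Im (g u))
    + (fun u => complex.Im (f u)) * (fun u => complex.Re (g u))); last first.
    by apply/funext => u /=; rewrite !fctE; case: (f u) (g u) => ? ? [].
  apply: is_derive_eq.
  case: (f t) (g t) df dg {rf mf rg mg} => ? ? [? ?] [? ?] [? ?] /=.
  by rewrite /GRing.scale /=; ring.
Qed.

Lemma is_cderive_conj f t df : is_cderive f t df ->
  is_cderive (fun u => Num.conj (f u)) t (Num.conj df).
Proof.
move=> [rf mf]; split.
- rewrite [X in is_derive _ _ X _](_ : _ = fun u => complex.Re (f u)).
    by case: df {mf} rf.
  by apply/funext => u /=; case: (f u).
- rewrite [X in is_derive _ _ X _](_ : _ = - (fun u => complex.Im (f u))).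
    by rewrite (_ : complex.Im _ = - complex.Im df);
      [exact: is_deriveN|case: df {rf mf}].
  by apply/funext => u /=; rewrite fctE; case: (f u).
Qed.

(** The inverse is the conjugate of [f] divided by the real function [N] = |f|^2, so both components
    follow from the real product and inverse rules. *)
Lemma is_cderiveV f t df : f t != 0 -> is_cderive f t df ->
  is_cderive (fun u => (f u)^-1) t (- (f t)^-2 * df).
Proof.
move=> f0 Df.
pose N := fun u => complex.Re (f u) ^+ 2 + complex.Im (f u) ^+ 2 : R.
have Nt : N t != 0.
  move: f0; rewrite /N; apply: contraNneq => /eqP.
  rewrite paddr_eq0 ?sqr_ge0// !sqrf_eq0 => /andP[/eqP a0 /eqP b0].
  by rewrite eq_complex a0 b0 eqxx.
have [rf mf] := Df.
have DN : is_derive t 1 N (2 * (complex.Re (f t) * complex.Re df +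
    complex.Im (f t) * complex.Im df)).
  rewrite (_ : N = (fun u => complex.Re (f u)) ^+ 2 +
    (fun u => complex.Im (f u)) ^+ 2) //.
  by apply: is_derive_eq; rewrite /GRing.scale /= !expr1; ring.
have DV := is_deriveV Nt DN.
split.
- rewrite [X in is_derive _ _ X _](_ : _ =
    (fun u => complex.Re (f u)) * (fun u => (N u)^-1)); last first.
    by apply/funext => u /=; rewrite !fctE /N; case: (f u).
  apply: is_derive_eq; move: Nt; rewrite /N {N DN DV}.
  case: (f t) df {f0 Df rf mf} => a b [c d] /= Nt; rewrite /GRing.scale /=.
  (* The denominator of [(f t)^-2] is |f^2|^2; writing it as the square of |f|^2 lets [Nt] discharge
     the side condition of [field]. *)
  rewrite (_ : (a * a - b * b) ^+ 2 + _ = (a ^+ 2 + b ^+ 2) ^+ 2); last by ring.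
  by field.
- rewrite [X in is_derive _ _ X _](_ : _ =
    - (fun u => complex.Im (f u)) * (fun u => (N u)^-1)); last first.
    apply/funext => u /=; rewrite !fctE /N.
    by case: (f u) => a b /=; rewrite mulNr.
  apply: is_derive_eq; rewrite fctE; move: Nt; rewrite /N {N DN DV}.
  case: (f t) df {f0 Df rf mf} => a b [c d] /= Nt; rewrite /GRing.scale /=.
  rewrite (_ : (a * a - b * b) ^+ 2 + _ = (a ^+ 2 + b ^+ 2) ^+ 2); last by ring.
  by field.
Qed.

End ComplexDerivative.

(** * Entrywise derivatives of complex matrices *)

Section MatrixDerivative.
Variable R : realType.
Implicit Types (t : R).

Definition is_mxderive m n (F : R -> 'M[R[i]]_(m, n)) t
    (dF : 'M[R[i]]_(m, n)) : Prop :=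
  forall i j, is_cderive (fun u => F u i j) t (dF i j).

Lemma is_mxderiveZ m n (f : R -> R[i]) (F : R -> 'M[R[i]]_(m, n)) t df dF :
  is_cderive f t df -> is_mxderive F t dF ->
  is_mxderive (fun u => f u *: F u) t (f t *: dF + df *: F t).
Proof.
move=> Df DF i j; under [X in is_cderive X]eq_fun do rewrite mxE.
by rewrite !mxE; exact: is_cderiveM.
Qed.

Lemma is_mxderiveM m n p (F : R -> 'M[R[i]]_(m, n)) (G : R -> 'M[R[i]]_(n, p))
    t dF dG :
  is_mxderive F t dF -> is_mxderive G t dG ->
  is_mxderive (fun u => F u *m G u) t (F t *m dG + dF *m G t).
Proof.
move=> DF DG i j; under [X in is_cderive X]eq_fun do rewrite mxE.
rewrite !mxE -big_split /=.
elim: (index_enum _) => [|k r IH].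
  under [X in is_cderive X]eq_fun do rewrite big_nil.
  by rewrite big_nil; exact: is_cderive_cst.
under [X in is_cderive X]eq_fun do rewrite big_cons.
by rewrite big_cons; apply: is_cderiveD => //; exact: is_cderiveM.
Qed.

Lemma is_mxderive_adj m n (F : R -> 'M[R[i]]_(m, n)) t dF :
  is_mxderive F t dF -> is_mxderive (fun u => (F u) ^t*) t (dF ^t*).
Proof.
move=> DF i j; under [X in is_cderive X]eq_fun do rewrite !mxE.
by rewrite !mxE; exact: is_cderive_conj.
Qed.

Lemma is_mxderive_mx2 (a b c d : R -> R[i]) t da db dc dd :
  is_cderive a t da -> is_cderive b t db -> is_cderive c t dc ->
  is_cderive d t dd ->
  is_mxderive (fun u => mx2 (a u) (b u) (c u) (d u)) t (mx2 da db dc dd).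
Proof.
move=> Da Db Dc Dd i j; under [X in is_cderive X]eq_fun do rewrite mxE.
by rewrite mxE; case: ifP => _; case: ifP => _.
Qed.

End MatrixDerivative.

(** * Explicit arithmetic of 2x2 matrices *)

Section Mx2.
Variable T : Type.

Lemma mx2E (A : 'M[T]_2) : A = mx2 (A 0 0) (A 0 1) (A 1 0) (A 1 1).
Proof.
apply/matrixP => i j; rewrite !mxE.
by case: i => [[|[|//]] ?]; case: j => [[|[|//]] ?] /=;
  congr (A _ _); apply/val_inj.
Qed.

End Mx2.

Lemma mulmx_mx2 (F : pzRingType) (a b c d a' b' c' d' : F) :
  mx2 a b c d *m mx2 a' b' c' d' =
  mx2 (a * a' + b * c') (a * b' + b * d') (c * a' + d * c') (c * b' + d * d').
Proof.
apply/matrixP => i j; rewrite !mxE big_ord_recl big_ord1 !mxE /=.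
by case: ifP => _; case: ifP => _.
Qed.

Lemma addmx_mx2 (F : pzRingType) (a b c d a' b' c' d' : F) :
  mx2 a b c d + mx2 a' b' c' d' = mx2 (a + a') (b + b') (c + c') (d + d').
Proof.
by apply/matrixP => i j; rewrite !mxE /=; case: ifP => _; case: ifP => _.
Qed.

Lemma scale_mx2 (F : pzRingType) (k a b c d : F) :
  k *: mx2 a b c d = mx2 (k * a) (k * b) (k * c) (k * d).
Proof.
by apply/matrixP => i j; rewrite !mxE /=; case: ifP => _; case: ifP => _.
Qed.

Lemma scalar_mx2 (F : pzRingType) (a : F) : a%:M = mx2 a 0 0 a.
Proof.
apply/matrixP => i j; rewrite !mxE.
by case: i => [[|[|//]] ?]; case: j => [[|[|//]] ?].
Qed.

Lemma det_mx2 (F : comPzRingType) (a b c d : F) :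
  \det (mx2 a b c d) = a * d - b * c.
Proof.
rewrite (expand_det_row _ 0) big_ord_recl big_ord1 /cofactor !det_mx11 !mxE /=.
by rewrite expr0 expr1 mul1r mulN1r mulrN.
Qed.

Lemma adj_mx2 (C : numClosedFieldType) (a b c d : C) :
  (mx2 a b c d) ^t* =
  mx2 (Num.conj a) (Num.conj c) (Num.conj b) (Num.conj d).
Proof.
by apply/matrixP => i j; rewrite !mxE /=; case: ifP => _; case: ifP => _.
Qed.

(** * The Weierstrass matrices as a Hermitian pencil *)

Section Frame.
Variable R : realType.
Implicit Types (s a b t : R) (z : R[i]) (E A : 'M[R[i]]_2).

Definition normsq z : R := complex.Re z ^+ 2 + complex.Im z ^+ 2.

Lemma normsqE z : (normsq z)%:C = z * Num.conj z.
Proof. by rewrite add_Re2_Im2 normCK. Qed.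

Lemma normsq_neq0 z : z != 0 -> normsq z != 0.
Proof.
move=> z0; apply: contra_neq z0 => N0.
apply/eqP; have := normsqE z; rewrite N0 => /esym/eqP.
by rewrite mulf_eq0 conjC_eq0 orbb.
Qed.

Lemma normsqM z w : normsq (z * w) = normsq z * normsq w.
Proof. by apply: complexI; rewrite rmorphM /= !normsqE rmorphM mulrACA. Qed.

Lemma normsqV z : normsq z^-1 = (normsq z)^-1.
Proof. by apply: complexI; rewrite fmorphV /= !normsqE fmorphV invfM. Qed.

Lemma normsq_real (r : R) : normsq r%:C = r ^+ 2.
Proof. by rewrite /normsq /= expr0n addr0. Qed.

Definition realT s z : R := 1 + s * normsq z.

Lemma realTE s z : (realT s z)%:C = 1 + s%:C * (z * Num.conj z).
Proof. by rewrite /realT rmorphD rmorphM rmorph1 /= normsqE. Qed.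

Lemma calTE s z : calT s z = (realT s z)%:C.
Proof. by rewrite realTE /calT normCK. Qed.

Lemma conj_div_real (r : R) z :
  Num.conj (r%:C / z) = r%:C / Num.conj z.
Proof. by rewrite fmorph_div /= conj_real_complex. Qed.

(** For real [\det E] this preserves determinants, so it is a Lorentz transformation of Hermitian
    matrices. *)
Definition frame_act E A : 'M[R[i]]_2 := (\det E)^-1 *: (E *m A *m E ^t*).

(* Up to the frame action, x is [pencil_mx s 1 (1 - s) g] and n is
   [pencil_mx s (-1) (1 + s) g]. *)
Definition pencil_mx s a b z : 'M[R[i]]_2 :=
  mx2 (a%:C * (realT s z)%:C) (- (a * s)%:C * z)
      (- (a * s)%:C * Num.conj z) ((a * s)%:C + b%:C / (realT s z)%:C).

(** The root of a positive real is real and that of a negative real is imaginary, so conjugation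
    multiplies it by the sign [e]. Both signs of T can thus be treated together. *)
Lemma sqrtC_real (y : R) (r := sqrtC (y%:C : R[i])) : y != 0 ->
  exists2 e : R[i], e ^+ 2 = 1 &
    [/\ Num.sg (y%:C) = e, Num.conj r = e * r & r ^+ 2 = y%:C].
Proof.
move=> y0; have r2 : r ^+ 2 = y%:C by exact: sqrtCK.
have r0 : r != 0.
  by apply: contra_neq y0 => r0; apply: complexI; rewrite -r2 r0 expr0n.
have rr_gt0 : 0 < r * Num.conj r by rewrite -normCK exprn_gt0// normr_gt0.
(* Equal squares give conj r = r or conj r = -r; positivity of r conj r then fixes the sign of
   [y]. *)
have /eqP : Num.conj r ^+ 2 = r ^+ 2.
  by rewrite -rmorphXn /= r2 conj_real_complex.
rewrite eqf_sqr => /orP[] /eqP cr; move: rr_gt0; rewrite cr.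
- rewrite -expr2 r2 => y_gt0; exists 1; rewrite ?expr1n// mul1r.
  by split=> //; exact: gtr0_sg.
- rewrite mulrN -expr2 r2 oppr_gt0 => y_lt0; exists (-1).
    by rewrite sqrrN expr1n.
  by rewrite mulN1r; split=> //; exact: ltr0_sg.
Qed.

(** The factor sgn T cancels the sign produced by conjugating the root of T, which leaves
    expressions rational in T. *)
Lemma weierstrass_mx_pencil s z E : calT s z != 0 ->
  weierstrass_mx s z E 1%:M = frame_act E (pencil_mx s 1 (1 - s) z) /\
  weierstrass_mx s z E (mx2 1 0 0 (-1)) =
    frame_act E (pencil_mx s (-1) (1 + s) z).
Proof.
rewrite /weierstrass_mx /weierstrass_L calTE fmorph_eq0 => T0.
have TE := realTE s z.
have [e e2 [-> cr r2]] := sqrtC_real T0.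
have T0' : (realT s z)%:C != 0 :> R[i] by rewrite fmorph_eq0.
set r := sqrtC _ in cr r2 *.
have r0 : r != 0 by apply: contra_neq T0' => r0; rewrite -r2 r0 expr0n.
rewrite -r2 in T0'.
have szz : s%:C * (z * Num.conj z) = r ^+ 2 - 1 by rewrite r2 TE addrC addKr.
have {}e2 : e = 1 \/ e = -1.
  by move/eqP: e2; rewrite sqrf_eq1 => /orP[] /eqP; [left|right].
have actE (L M : 'M[R[i]]_2) :
    (e / \det E) *: (E *m L *m M *m (E *m L) ^t*) =
    frame_act E (e *: (L *m M *m L ^t*)).
  by rewrite /frame_act trmx_mul map_mxM /= -scalemxAr -scalemxAl scalerA
    (mulrC e) !mulmxA.
split; rewrite actE ?mulmx1; congr frame_act;
  rewrite adj_mx2 !mulmx_mx2 scale_mx2 /pencil_mx -!r2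
    !(rmorphM, rmorphN, fmorphV, rmorph0, rmorph1) !(conj_real_complex, conjCK,
      cr) /=.
all: rewrite !(rmorphB, rmorphD, rmorphM, rmorphN, rmorph1) /=.
all: congr mx2.
all: rewrite ?conjCK ?conj_real_complex ?cr.
(* The lower right entries (1 + s^2 |z|^2) / T and (1 - s^2 |z|^2) / T take the form a s + b / T
   once s |z|^2 is replaced by T - 1. *)
4: transitivity ((1 + s%:C * (s%:C * (z * Num.conj z))) / r ^+ 2);
  last by rewrite szz; field.
8: transitivity ((1 - s%:C * (s%:C * (z * Num.conj z))) / r ^+ 2);
  last by rewrite szz; field.
all: by case: e2 r0 => -> r0; field.
Qed.

(** * Derivative and difference of the pencil, read in the moving frame *)

Lemma is_mxderive_pencil s a b (g : R -> R[i]) t h (T := (realT s (g t))%:C) :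
  realT s (g t) != 0 -> is_cderive g t h ->
  let d := s%:C * (g t * Num.conj h + h * Num.conj (g t)) in
  is_mxderive (fun u => pencil_mx s a b (g u)) t
    (mx2 (a%:C * d)                     (- (a * s)%:C * h)
         (- (a * s)%:C * Num.conj h)    (- b%:C * d / T ^+ 2)).
Proof.
move=> T0 Dg d.
have T0' : T != 0 by rewrite fmorph_eq0.
have Dcst c : is_cderive (fun=> c : R[i]) t 0 by exact: is_cderive_cst.
have DT : is_cderive (fun u => (realT s (g u))%:C) t d.
  under [X in is_cderive X]eq_fun do rewrite realTE.
  apply: is_cderive_eq; first apply: is_cderiveD (Dcst _) _.
    exact: is_cderiveM (Dcst _) (is_cderiveM Dg (is_cderive_conj Dg)).
  by rewrite /d mul0r addr0 add0r.
apply: is_mxderive_mx2.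
- by apply: is_cderive_eq (is_cderiveM (Dcst _) DT) _; rewrite mul0r addr0.
- by apply: is_cderive_eq (is_cderiveM (Dcst _) Dg) _; rewrite mul0r addr0.
- apply: is_cderive_eq (is_cderiveM (Dcst _) (is_cderive_conj Dg)) _.
  by rewrite mul0r addr0.
- apply: is_cderive_eq.
    apply: is_cderiveD (Dcst _) _.
    exact: is_cderiveM (Dcst _)
      (is_cderiveV (f := fun u => (realT s (g u))%:C) T0' DT).
  by rewrite -/T; field.
Qed.

(** Liouville's formula: the logarithmic derivative of [E] has trace zero. *)
Lemma is_cderive_det (E : R -> 'M[R[i]]_2) t h c :
  is_mxderive E t (E t *m mx2 0 h c 0) ->
  is_cderive (fun u => \det (E u)) t 0.
Proof.
move=> DE; under [X in is_cderive X]eq_fun do rewrite [E _]mx2E det_mx2.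
have DN (f : R -> R[i]) df :
    is_cderive f t df -> is_cderive (fun u => - f u) t (- df).
  move=> Df; under [X in is_cderive X]eq_fun do rewrite -mulN1r.
  apply: is_cderive_eq (is_cderiveM (is_cderive_cst (-1) t) Df) _.
  by rewrite mul0r addr0 mulN1r.
apply: is_cderive_eq.
  apply: is_cderiveD (is_cderiveM (DE 0 0) (DE 1 1)) _.
  exact: DN (is_cderiveM (DE 0 1) (DE 1 0)).
rewrite [in E t *m _](mx2E (E t)) mulmx_mx2 !mxE /=; ring.
Qed.

(** As the determinant is stationary, only the product rule for E N and the adjoint of E
    contributes, and E' = E U lets the outer factors be pulled out. *)
Lemma is_mxderive_frame_act (E N : R -> 'M[R[i]]_2) t h c dN
    (U := mx2 0 h c 0) :
  \det (E t) != 0 -> is_mxderive E t (E t *m U) -> is_mxderive N t dN ->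
  is_mxderive (fun u => frame_act (E u) (N u)) t
    (frame_act (E t) (U *m N t + N t *m U ^t* + dN)).
Proof.
move=> d0 DE DN.
have Dd := is_cderiveV (f := fun u => \det (E u)) d0 (is_cderive_det DE).
have := is_mxderiveZ Dd
  (is_mxderiveM (is_mxderiveM DE DN) (is_mxderive_adj DE)).
rewrite mulr0 scale0r addr0 /frame_act.
rewrite trmx_mul map_mxM /= !mulmxDr !mulmxDl !mulmxA; congr is_mxderive.
by rewrite addrA addrC addrA.
Qed.

(* The directions, read in the frame, of the t-derivative and of the difference
   of [pencil_mx s a b g]: they do not depend on [a] and [b]. *)
Definition deriv_dir s z h : 'M[R[i]]_2 :=
  mx2 0 ((realT s z)%:C * h) ((realT s z)%:C * Num.conj h)
      (- s%:C * (z * Num.conj h + h * Num.conj z)).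

Definition diff_dir s w z d : 'M[R[i]]_2 :=
  mx2 ((realT s z)%:C * (d * Num.conj d)) ((realT s z)%:C * d)
      ((realT s z)%:C * Num.conj d)
      ((realT s z)%:C - w%:C * (realT s (z + d))%:C).

(** The left side is the t-derivative read in the frame, with l = lambda tau. In the upper left
    corner [d], the derivative of T, cancels the off-diagonal terms; the other entries share one
    real factor. *)
Lemma pencil_deriv s a b z h l (U := mx2 0 h (l%:C / h) 0)
    (d := s%:C * (z * Num.conj h + h * Num.conj z)) :
  realT s z != 0 -> h != 0 ->
  U *m pencil_mx s a b z + pencil_mx s a b z *m U ^t* +
    mx2 (a%:C * d)                     (- (a * s)%:C * h)
        (- (a * s)%:C * Num.conj h)    (- b%:C * d / (realT s z)%:C ^+ 2) =
  (a * (l / normsq h) + b / realT s z ^+ 2)%:C *: deriv_dir s z h.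
Proof.
move=> T0 h0; have cV := conj_div_real l h.
have asE := rmorphM (real_complex R) a s.
have hb0 : Num.conj h != 0 by rewrite conjC_eq0.
rewrite adj_mx2 !mulmx_mx2 !addmx_mx2 scale_mx2 /pencil_mx /deriv_dir /d.
have nE := normsqE h; move: (normsq h) (realT s z) T0 nE => n T.
rewrite -(fmorph_eq0 (real_complex R)) /= => T0 nE.
have -> : (a * (l / n) + b / T ^+ 2)%:C =
    a%:C * (l%:C / (h * Num.conj h)) + b%:C / T%:C ^+ 2.
  by rewrite -nE !(rmorphD, rmorphM, fmorphV, rmorphXn).
rewrite /= in asE; rewrite cV !rmorph0 asE.
by congr mx2; field; rewrite ?T0 ?h0 ?hb0.
Qed.

(** [V] is the transition matrix from one end of the edge to the other, with determinant [w]; the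
    left side is the difference read in the frame of the first end. *)
Lemma pencil_step s a b z d l (w := 1 - l) (V := mx2 1 d (l%:C / d) 1) :
  realT s z != 0 -> realT s (z + d) != 0 -> d != 0 -> w != 0 ->
  w%:C^-1 *: (V *m pencil_mx s a b (z + d) *m V ^t*) - pencil_mx s a b z =
  (w^-1 * (a * (l / normsq d) + b / (realT s z * realT s (z + d))))%:C
    *: diff_dir s w z d.
Proof.
move=> T0 T10 d0 w0; have cV := conj_div_real l d.
have asE := rmorphM (real_complex R) a s.
have zdE := rmorphD (@Num.conj R[i]) z d.
have db0 : Num.conj d != 0 by rewrite conjC_eq0.
rewrite -scaleN1r adj_mx2 !mulmx_mx2 !scale_mx2 !addmx_mx2.
rewrite /pencil_mx /diff_dir /w.
rewrite /= in asE zdE; rewrite cV !rmorph1 asE zdE.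
have := normsqE d; have := realTE s (z + d); have := realTE s z.
move: w0; rewrite /w -(fmorph_eq0 (real_complex R)) rmorphB rmorph1 /=.
move: (normsq d) (realT s z) (realT s (z + d)) T0 T10 => n T T1.
rewrite -2!(fmorph_eq0 (real_complex R)) /= => T0 T10 w0 TE T1E nE.
have -> : ((1 - l)^-1 * (a * (l / n) + b / (T * T1)))%:C =
    (1 - l%:C)^-1 *
    (a%:C * (l%:C / (d * Num.conj d)) + b%:C / (T%:C * T1%:C)).
  by rewrite -nE !(rmorphD, rmorphM, fmorphV, rmorphN, rmorph1).
rewrite (rmorphB (real_complex R)) rmorph1 /=.
(* With T and T_1 expanded, each entry is a rational identity in z, d, their conjugates and the real
   parameters. *)
move: T0 T10; rewrite TE T1E zdE => T0 T10.
by congr mx2; field; rewrite ?d0 ?db0 ?T0 ?w0 ?T10.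
Qed.

(** By the cross-ratio condition the derivative of g at the second end is [q], so q/d = -m conj(h/d)
    with [m] real. The value of [c] is forced by the upper left entry, where [deriv_dir]
    vanishes. *)
Lemma deriv_dir_coplanar s z h d l r (w := 1 - l) (V := mx2 1 d (l%:C / d) 1)
    (q := r%:C * d ^+ 2 / h) (m := - (r * normsq d / normsq h))
    (c := m%:C * (realT s (z + d))%:C * (h / d + Num.conj (h / d))
          + s%:C * (q * Num.conj (z + d) + Num.conj q * (z + d))) :
  h != 0 -> d != 0 ->
  (m * w * realT s (z + d))%:C *: deriv_dir s z h
    - (realT s z)%:C *: (V *m deriv_dir s (z + d) q *m V ^t*) =
  (complex.Re c)%:C *: diff_dir s w z d.
Proof.
move=> h0 d0; have cV := conj_div_real l d.
have zdE := rmorphD (@Num.conj R[i]) z d.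
(* [c] equals its own conjugate, so its real part may be replaced by [c] itself. *)
rewrite -complex_conj_fixed; last first.
  rewrite /c; move: (q) (m) (h / d) (z + d) (realT _ _) => q' m' e y T.
  rewrite !(rmorphD, rmorphM) /= !conjCK !conj_real_complex.
  by rewrite (addrC (Num.conj e)) (addrC (_ * y)).
have hb0 : Num.conj h != 0 by rewrite conjC_eq0.
have db0 : Num.conj d != 0 by rewrite conjC_eq0.
rewrite -scaleN1r adj_mx2 !mulmx_mx2 !scale_mx2 !addmx_mx2.
rewrite /deriv_dir /diff_dir /c /w /m.
have := normsqE h; have := normsqE d.
have := realTE s (z + d); have := realTE s z.
move: (normsq d) (normsq h) (realT s z) (realT s (z + d)).
move=> n n' T T1 TE T1E nE nE'.
have qbE : Num.conj q = r%:C * Num.conj d ^+ 2 / Num.conj h.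
  by rewrite /q !(rmorphD, rmorphM, fmorphV, rmorphN, rmorphXn) /=
    conj_real_complex.
have mE : (- (r * n / n'))%:C =
    - (r%:C * (d * Num.conj d) / (h * Num.conj h)).
  by rewrite -nE -nE' !(rmorphN, rmorphM, fmorphV).
have wE : (- (r * n / n') * (1 - l) * T1)%:C =
    - (r%:C * (d * Num.conj d) / (h * Num.conj h)) * (1 - l%:C) * T1%:C.
  by rewrite !(rmorphM _ (_ * _)) /= rmorphM /= mE rmorphB rmorph1.
rewrite /= in zdE.
rewrite wE mE cV !rmorph1 (rmorphB (real_complex R)) rmorph1 /= TE T1E zdE qbE.
rewrite fmorph_div /q.
by congr mx2; field; rewrite ?d0 ?db0 ?h0 ?hb0.
Qed.

End Frame.

(** * From Hermitian matrices back to vectors of Minkowski space *)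

Section Coordinates.
Variable R : realType.
Implicit Types (s a b t : R) (z : R[i]) (A B : 'M[R[i]]_2).

(** The inverse of the Hermitian identification, extended real-linearly to all complex 2x2 matrices
    so that no Hermitian condition has to be carried along. *)
Definition mx_coord A (j : nat) : R :=
  match j with
  | 0%N => complex.Re (A 1 0)
  | 1%N => complex.Im (A 1 0)
  | 2%N => (complex.Re (A 0 0) - complex.Re (A 1 1)) / 2
  | _ => (complex.Re (A 0 0) + complex.Re (A 1 1)) / 2
  end.

Definition mx_vec A : 'rV[R]_4 := \row_j mx_coord A j.

Lemma herm_mxK : cancel (@herm_mx R) mx_vec.
Proof.
move=> z; apply/rowP => j; rewrite !mxE.
case: j => [[|[|[|[|//]]]] lj]; rewrite /mx_coord /= !mxE /= /z0 /z1 /z2 /z3.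
- by congr (z _ _); apply/val_inj; rewrite /= inordK.
- by congr (z _ _); apply/val_inj; rewrite /= inordK.
- transitivity (z 0 (inord 2)); first by field.
  by congr (z _ _); apply/val_inj; rewrite /= inordK.
- transitivity (z 0 (inord 3)); first by field.
  by congr (z _ _); apply/val_inj; rewrite /= inordK.
Qed.

Lemma mx_vecD A B : mx_vec (A + B) = mx_vec A + mx_vec B.
Proof.
apply/rowP => j; rewrite !mxE.
by case: j => [[|[|[|[|//]]]] lj]; rewrite /mx_coord /= !mxE !raddfD /=; field.
Qed.

Lemma mx_vecZ a A : mx_vec (a%:C *: A) = a *: mx_vec A.
Proof.
apply/rowP => j; rewrite !mxE.
by case: j => [[|[|[|[|//]]]] lj]; rewrite /mx_coord /= !mxE;
  case: (A 1 0) (A 0 0) (A 1 1) => ? ? [? ?] [? ?] /=; field.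
Qed.

Lemma is_derive_mx_vec (F : R -> 'M[R[i]]_2) t dF :
  is_mxderive F t dF -> is_derive t 1 (fun u => mx_vec (F u)) (mx_vec dF).
Proof.
move=> DF.
have Dj (i : 'I_1) (j : 'I_4) :
    is_derive t 1 (fun u => mx_vec (F u) i j) (mx_vec dF i j).
  have [[r00 _] [r10 i10] [r11 _]] := And3 (DF 0 0) (DF 1 0) (DF 1 1).
  under [X in is_derive _ _ X _]eq_fun do rewrite mxE.
  rewrite mxE; case: j => [[|[|[|[|//]]]] lj] //=.
  - under [X in is_derive _ _ X _]eq_fun do rewrite mulrC.
    rewrite mulrC; apply: is_deriveZ; exact: is_deriveB.
  - under [X in is_derive _ _ X _]eq_fun do rewrite mulrC.
    rewrite mulrC; apply: is_deriveZ; exact: is_deriveD.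
have DM : derivable (fun u => mx_vec (F u)) t 1.
  by apply/derivable_mxP => i j; have [] := Dj i j.
apply: DeriveDef => //; rewrite derive_mx //.
by apply/matrixP => i j; rewrite mxE; have [] := Dj i j.
Qed.

End Coordinates.

(** * Mixed areas and curvatures relative to a single bivector *)

Section Wedge.
Variable R : realType.
Implicit Types (a b : R) (u v w : 'rV[R]_4).

Lemma lorentzDl u v w : lorentz (u + v) w = lorentz u w + lorentz v w.
Proof. by rewrite /lorentz /z0 /z1 /z2 /z3 !mxE; ring. Qed.

Lemma lorentzZl a u v : lorentz (a *: u) v = a * lorentz u v.
Proof. by rewrite /lorentz /z0 /z1 /z2 /z3 !mxE; ring. Qed.

(** The wedge is alternating, so the component along [v] drops out. *)
Lemma wedge_span u v a b c :
  wedge (a *: u + b *: v) (c *: v) = (a * c) *: wedge u v.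
Proof.
apply/funext => e; rewrite -[RHS]/((a * c) *: wedge u v e).
rewrite /wedge lorentzDl !lorentzZl.
by apply/rowP => j; rewrite !mxE; ring.
Qed.

Lemma mixed_area_span (x n : int -> R -> 'rV[R]_4) k t u v a b c a' b' c' :
  derive1 (x k) t + derive1 (x (k + 1)) t = a *: u + b *: v ->
  sdiff x k t = c *: v ->
  derive1 (n k) t + derive1 (n (k + 1)) t = a' *: u + b' *: v ->
  sdiff n k t = c' *: v ->
  mixed_area x n k t = ((a * c' + a' * c) / 4) *: wedge u v.
Proof.
move=> dx sx dn sn; rewrite /mixed_area dx sx dn sn !wedge_span.
by rewrite -scalerDl scalerA mulrC.
Qed.

(** Here H = -r/p and K = q/p, so the claim multiplied by [p] is the assumed linear relation between
    [p], [q] and [r]. *)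
Lemma curvature_span (x n : int -> R -> 'rV[R]_4) k t
    (V : 'rV[R]_4 -> 'rV[R]_4) p q r (al be : R) :
  mixed_area x x k t = p *: V ->
  mixed_area n n k t = q *: V ->
  mixed_area x n k t = r *: V ->
  al * (r + p) = be * (q - p) ->
  mixed_area x x k t <> 0 ->
  al * (mean_curvature x n k t - 1) + be * (gauss_curvature x n k t - 1) = 0.
Proof.
move=> xx nn xn lin.
rewrite /mean_curvature /gauss_curvature xx nn xn => pV.
have p0 : p != 0 by apply: contra_notN pV => /eqP ->; rewrite scale0r.
have V0 : V != 0 by apply: contra_notN pV => /eqP ->; rewrite scaler0.
(* [get] returns a solution because -r/p is one; likewise q/p for the Gaussian curvature. *)
have HH : r *: V = - get [set H : R | r *: V = - H *: (p *: V)] *: (p *: V).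
  by apply: (@getI _ [set H : R | r *: V = - H *: (p *: V)] (- (r / p)));
    rewrite /= scalerA opprK divfK.
have KK : q *: V = get [set H : R | q *: V = H *: (p *: V)] *: (p *: V).
  by apply: (@getI _ [set H : R | q *: V = H *: (p *: V)] (q / p));
    rewrite /= scalerA divfK.
move: (get _) HH (get _) KK => H + K; rewrite !scalerA => HH KK.
have [h0 v0] : r = - H * p /\ q = K * p.
  (* Since [V] is nonzero, coefficients can be compared; this identifies the values chosen by
     [get]. *)
  have inj c d : c *: V = d *: V -> c = d.
    move/eqP; rewrite -subr_eq0 -scalerBl => /eqP cd.
    apply/eqP; rewrite -subr_eq0; apply: contra_neqT V0 => cd0.
    by apply: (scalerI cd0); rewrite cd scaler0.
  by split; apply: inj.
apply: (mulIf p0); rewrite mul0r.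
transitivity (- (al * (r + p)) + be * (q - p)); last by rewrite lin addNr.
by rewrite h0 v0; ring.
Qed.

End Wedge.

(** * Vectors read in a frame and change of frame along an edge *)

Section FrameVector.
Variable R : realType.
Implicit Types (a : R) (E A B : 'M[R[i]]_2).

Definition frame_vec E A : 'rV[R]_4 := mx_vec (frame_act E A).

Lemma frame_vecD E A B : frame_vec E (A + B) = frame_vec E A + frame_vec E B.
Proof. by rewrite /frame_vec /frame_act mulmxDr mulmxDl scalerDr mx_vecD. Qed.

Lemma frame_vecZ E a A : frame_vec E (a%:C *: A) = a *: frame_vec E A.
Proof.
by rewrite /frame_vec /frame_act -scalemxAr -scalemxAl scalerA mulrC -scalerA
  mx_vecZ.
Qed.

Lemma frame_vecB E A B : frame_vec E (A - B) = frame_vec E A - frame_vec E B.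
Proof.
by rewrite -scaleN1r -(rmorphN1 (real_complex R)) frame_vecD frame_vecZ
  scaleN1r.
Qed.

(** The factor (1 - l)^-1 is the inverse of det V. Data at the second end of an edge can thereby be
    read in the frame of the first. *)
Lemma frame_vec_step E d l A (V := mx2 1 d (l%:C / d) 1) : d != 0 ->
  frame_vec (E *m V) A = (1 - l)^-1 *: frame_vec E (V *m A *m V ^t*).
Proof.
move=> d0; rewrite -frame_vecZ /frame_vec /frame_act det_mulmx; congr mx_vec.
rewrite /V det_mx2 mulr1 [d * _]mulrC divfK // trmx_mul map_mxM /=.
rewrite -scalemxAr -scalemxAl scalerA invfM fmorphV rmorphB rmorph1 /=.
by rewrite mulrC !mulmxA.
Qed.

End FrameVector.

(** * The edge data common to all members of the pencil *)

Section EdgeData.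
Variables (R : realType) (D : int -> set R) (g : int -> R -> R[i]).
Variables (tau : R -> R) (sigma : int -> R) (s lambda : R).
Variable E : int -> R -> 'M[R[i]]_2.
Hypothesis openD : sd_domain D.
Hypothesis holg : sd_holomorphic D g tau sigma.
Hypothesis T_neq0 : forall k t, D k t -> calT s (g k t) != 0.
Hypothesis w_neq0 : forall k t, edge D k t -> 1 - lambda * sigma k != 0.
Hypothesis frameE : weierstrass_frame D g tau sigma lambda E.

Lemma derive1_pencil (y : int -> R -> 'rV[R]_4) a b k t (h := cderive (g k) t) :
  (forall k t, D k t ->
     herm_mx (y k t) = frame_act (E k t) (pencil_mx s a b (g k t))) ->
  D k t ->
  derive1 (y k) t =
    (a * (lambda * tau t / normsq h) + b / realT s (g k t) ^+ 2) *:
      frame_vec (E k t) (deriv_dir s (g k t) h).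
Proof.
move=> yE Dt; have [sg h0 _ _] := holg; have [sE uE _ _ dE] := frameE.
have T0 : realT s (g k t) != 0 by have := T_neq0 Dt; rewrite calTE fmorph_eq0.
have DE : is_mxderive (E k) t
    (E k t *m mx2 0 h ((lambda * tau t)%:C / h) 0).
  rewrite -dE // mulKVmx ?uE // => i j; rewrite mxE.
  exact: is_cderive_smooth (sE k i j) Dt.
have DN := is_mxderive_pencil a b T0 (is_cderive_smooth (sg k) Dt).
have det0 : \det (E k t) != 0 by have := uE k t Dt; rewrite unitmxE unitfE.
have := is_derive_mx_vec (is_mxderive_frame_act det0 DE DN).
rewrite pencil_deriv // ?h0 // => Dy.
rewrite derive1E -frame_vecZ.
suff : is_derive t 1 (y k) (mx_vec (frame_act (E k t)
    ((a * (lambda * tau t / normsq h) + b / realT s (g k t) ^+ 2)%:C *: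
      deriv_dir s (g k t) h))) by case.
(* The pencil formula for [y] holds only over the domain; as its slice is open, it holds near [t],
   which suffices for the derivative. *)
apply: near_eq_is_derive Dy.
near=> u; rewrite -yE ?herm_mxK //.
near: u; apply: open_nbhs_nbhs; split; [exact: openD|exact: Dt].
Unshelve. all: by end_near.
Qed.

Lemma frame_step k t (d := sdiff g k t) : edge D k t ->
  E (k + 1) t = E k t *m mx2 1 d ((lambda * sigma k)%:C / d) 1.
Proof.
move=> Dkt; have [_ uE _ dE _] := frameE.
have := congr1 (fun A => E k t *m A) (dE k t Dkt).
rewrite mulKVmx ?uE //; last by case: Dkt.
rewrite /sdiff => /eqP; rewrite subr_eq => /eqP ->.
rewrite -[X in _ + X]mulmx1 -mulmxDr; congr (_ *m _).
by rewrite scalar_mx2 addmx_mx2 !addr0 !add0r.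
Qed.

Lemma sdiff_pencil (y : int -> R -> 'rV[R]_4) a b k t (d := sdiff g k t)
    (l := lambda * sigma k) :
  (forall k t, D k t ->
     herm_mx (y k t) = frame_act (E k t) (pencil_mx s a b (g k t))) ->
  edge D k t ->
  sdiff y k t =
    ((1 - l)^-1 * (a * (l / normsq d) +
       b / (realT s (g k t) * realT s (g (k + 1) t)))) *:
    frame_vec (E k t) (diff_dir s (1 - l) (g k t) d).
Proof.
move=> yE Dkt; have [Dt D1t] := Dkt; have [_ _ d0 _] := holg.
have gE : g (k + 1) t = g k t + d by rewrite /d /sdiff [RHS]addrC subrK.
have T0 : realT s (g k t) != 0 by have := T_neq0 Dt; rewrite calTE fmorph_eq0.
have T10 : realT s (g k t + d) != 0.
  by have := T_neq0 D1t; rewrite calTE fmorph_eq0 gE.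
rewrite /sdiff -[y (k + 1) t]herm_mxK -[y k t]herm_mxK !yE // frame_step //.
rewrite -!/(frame_vec _ _) frame_vec_step ?d0 // -frame_vecZ -frame_vecB.
rewrite -frame_vecZ gE fmorphV /=; congr frame_vec; apply: pencil_step => //.
- exact: d0.
- exact: w_neq0 Dkt.
Qed.

(** All data are chosen before [y], [a] and [b], so that x and n share them. The coefficient [c]
    along [v] is left unspecified because mixed areas do not see it. *)
Lemma edge_span k t : edge D k t ->
  exists (u v : 'rV[R]_4) (rho nu e th : R),
    forall (y : int -> R -> 'rV[R]_4) a b,
    (forall k t, D k t ->
       herm_mx (y k t) = frame_act (E k t) (pencil_mx s a b (g k t))) ->
    (exists c, derive1 (y k) t + derive1 (y (k + 1)) t =
                 (rho * (b * th - a * e)) *: u + c *: v) /\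
    sdiff y k t = (nu * (a * e + b * th)) *: v.
Proof.
move=> Dkt; have [Dt D1t] := Dkt; have [_ h0 d0 hol] := holg.
set h := cderive (g k) t; set q := cderive (g (k + 1)) t.
set d := sdiff g k t; set l := lambda * sigma k.
set T := realT s (g k t); set T1 := realT s (g (k + 1) t).
set r := tau t / sigma k.
have [hE r_lt0] := hol k t Dkt; rewrite -/r in hE r_lt0.
have {}h0 k' : D k' t -> cderive (g k') t != 0 by exact: h0.
have hn0 : h != 0 by exact: h0.
have dn0 : d != 0 by exact: d0.
have r0 : r != 0 by rewrite lt_eqF.
have sg0 : sigma k != 0.
  by apply: contra_neq r0; rewrite /r => ->; rewrite invr0 mulr0.
(* Expresses lambda tau through l = lambda sigma, so that derivatives and differences involve the
   same parameter. *)
have tauE : lambda * tau t = l * r by rewrite /l /r; field.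
have T0 : T != 0 by have := T_neq0 Dt; rewrite calTE fmorph_eq0.
have T10 : T1 != 0 by have := T_neq0 D1t; rewrite calTE fmorph_eq0.
have w0 : 1 - l != 0 by exact: w_neq0 Dkt.
have gE : g (k + 1) t = g k t + d by rewrite /d /sdiff [RHS]addrC subrK.
have qE : q = r%:C * d ^+ 2 / h.
  by rewrite -hE -/h -/q -/d divfK ?expf_neq0 // mulrC mulKf.
have nh0 := normsq_neq0 hn0; have nd0 := normsq_neq0 dn0.
have nqE : normsq q = r ^+ 2 * normsq d ^+ 2 / normsq h.
  by rewrite qE !(normsqM, normsqV) normsq_real -expr2.
pose m := - (r * normsq d / normsq h).
pose eta := frame_vec (E k t).
pose u := eta (deriv_dir s (g k t) h).
pose v := eta (diff_dir s (1 - l) (g k t) d).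
pose V := mx2 1 d (l%:C / d) 1.
(* Coplanarity, divided by T: the derivative direction at the second end is a combination of [u] and
   [v]. *)
have [c0 zE] : exists c0, eta (V *m deriv_dir s (g (k + 1) t) q *m V ^t*) =
    ((1 - l) * (m * T1 / T)) *: u - (c0 / T) *: v.
  have := deriv_dir_coplanar s (g k t) l r hn0 dn0.
  rewrite -qE -gE -/T1 -/T -/m -/V.
  set c0 := complex.Re _ => H; exists c0.
  have := congr1 eta H; rewrite /eta frame_vecB !frame_vecZ.
  rewrite -/eta -/u -/v => {}H.
  by rewrite (solve_scaled T0 H) -mulrA mulrCA -!mulrA.
(* Along [u] the first end contributes -m a e + (T_1/T) b th and the second -(T_1/T) a e + m b th;
   the sum has the factor m + T_1/T. *)
exists u, v, (m + T1 / T), (1 - l)^-1, (l / normsq d), (T * T1)^-1.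
move=> y a b yE; split; last exact: sdiff_pencil.
rewrite !(derive1_pencil yE) // -/h -/q -/T -/T1 frame_step // -/d -/l -/V.
rewrite frame_vec_step // -/V -/eta zE -/u tauE.
(* The coefficient of [v] is found by unification, with [u] and [v] kept opaque. *)
clearbody u v; eexists.
rewrite scalerBr scalerBr !scalerA addrA -scalerDl -scaleNr.
congr (_ *: _ + _ *: _).
by rewrite nqE /m; field; rewrite ?w0 ?nh0 ?nd0 ?T0 ?T10 ?r0.
Qed.

End EdgeData.

(** * The linear relations between mean and Gaussian curvature *)

Theorem proposition4p3 (R : realType) (D : int -> set R)
    (g : int -> R -> R[i]%C) (tau : R -> R) (sigma : int -> R) (s lambda : R)
    (E : int -> R -> 'M[R[i]%C]_2) (x n : int -> R -> 'rV[R]_4) :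
  sd_domain D ->
  sd_holomorphic D g tau sigma ->
  (forall k t, D k t -> calT s (g k t) != 0) ->
  lambda != 0 ->
  (forall k t, edge D k t -> 1 - lambda * sigma k != 0) ->
  weierstrass_frame D g tau sigma lambda E ->
  BrLW_BiLW D g s E x n ->
  forall k t, edge D k t ->
    (mixed_area x x k t <> 0 ->
       2 * s * (mean_curvature x n k t - 1)
         + (1 - s) * (gauss_curvature x n k t - 1) = 0) /\
    (mixed_area n n k t <> 0 ->
       2 * s * (mean_curvature n x k t - 1)
         - (1 + s) * (gauss_curvature n x k t - 1) = 0).
Proof.
move=> openD holg T0 _ w0 frameE xn k t Dkt.
have [u [v [rho [nu [e [th span]]]]]] := edge_span openD holg T0 w0 frameE Dkt.
have xE k' t' : D k' t' ->
    herm_mx (x k' t') = frame_act (E k' t') (pencil_mx s 1 (1 - s) (g k' t')).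
  by move=> Dt; have [-> _] := xn k' t' Dt;
    have [] := weierstrass_mx_pencil (E k' t') (T0 _ _ Dt).
have nE k' t' : D k' t' ->
    herm_mx (n k' t') =
    frame_act (E k' t') (pencil_mx s (-1) (1 + s) (g k' t')).
  by move=> Dt; have [_ ->] := xn k' t' Dt;
    have [] := weierstrass_mx_pencil (E k' t') (T0 _ _ Dt).
have [[c dx] sx] := span x _ _ xE; have [[c' dn] sn] := span n _ _ nE.
have xx := mixed_area_span dx sx dx sx; have nn := mixed_area_span dn sn dn sn.
split=> A0.
(* Up to a common factor, r + p = 2 (1 - s) th^2 and q - p = 4 s th^2: the terms in e^2 cancel. *)
- apply: (curvature_span xx nn (mixed_area_span dx sx dn sn)) A0; by field.
(* With the roles of x and n exchanged, the second coefficient is -(1 + s), and r + p = 2 (1 + s)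
   th^2, q - p = -4 s th^2 up to the same factor. *)
- rewrite -mulNr.
  apply: (curvature_span nn xx (mixed_area_span dn sn dx sx)) A0; by field.
Qed.
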